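(* Let $\mathcal{C}$ be a class of probability measures on a constructive metric space $X$. (a) If $\mathcal{C}$ is a Borel class that is orthogonal, then a separator for $\mathcal{C}$ exists. (b) $\mathcal{C}$ is effectively orthogonal if and only if there exists a test-separator for $\mathcal{C}$.
   Context: A constructive metric space $(X,d,D,\alpha)$ is a complete separable metric space with a numbered dense countable set $D$ on which $d$ is uniformly computable; basic balls have centres in $D$ and rational radii. $\mathcal{M}(X)$, the probability measures on $X$ with the Prokhorov metric and dense set of rational finitely supported measures on $D$, is again a constructive metric space. A function $f:X\times\mathcal{M}(X)\to[0,\infty]$ is lower semicomputable if each $\{f>r\}$, $r$ rational, is a union of an enumerable family of products of basic balls, uniformly in $r$. A uniform test is such $f$ with $\int f(x,P)\,dP(x)\le1$ for all $P$; with $\mathbf{t}$ a universal one, $\mathrm{Randoms}(P)=\{x:\mathbf{t}(x,P)<\infty\}$. $\mathcal{C}$ is effectively orthogonal if $\mathrm{Randoms}(P)\cap\mathrm{Randoms}(Q)=\varnothing$ for distinct $P,Q\in\mathcal{C}$. $\mathcal{C}$ is orthogonal if there is a Borel measurable $\varphi:X\to\mathcal{C}$ with $P(\varphi^{-1}(P))=1$ for every $P\in\mathcal{C}$. A separator for $\mathcal{C}$ is a Borel measurable $s:X\times\mathcal{M}(X)\to[0,\infty]$ with $\int s(x,P)\,dP(x)\le1$ for all measures $P$, such that for all distinct $P,Q\in\mathcal{C}$ and every $x$ at least one of $s(x,P),s(x,Q)$ is infinite; a test-separator is a separator that is lower semicomputable. *)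

(* Defs.v *)
From HB Require Import structures.
From mathcomp Require Import all_boot all_order all_algebra.
From mathcomp Require Import all_classical all_reals all_analysis.
From mathcomp Require Import measurable_realfun.
Set Implicit Arguments.
Unset Strict Implicit.
Unset Printing Implicit Defensive.
Import Order.TTheory GRing.Theory Num.Theory.
Import numFieldNormedType.Exports.
Local Open Scope classical_set_scope.
Local Open Scope ring_scope.

(** Kleene's mu-recursive functions; [rec_eval f s y] states that [f] converges
    on the argument list [s] with value [y]. *)
Inductive recf : Type :=
  | RZero
  | RSucc
  | RProj of nat
  | RComp of recf & seq recf
  | RPrec of recf & recf
  | RMin of recf.

Inductive rec_eval : recf -> seq nat -> nat -> Prop :=
  | eval_zero s : rec_eval RZero s 0%N
  | eval_succ x s : rec_eval RSucc (x :: s) x.+1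
  | eval_proj i s : (i < size s)%N -> rec_eval (RProj i) s (nth 0%N s i)
  | eval_comp f gs s t y :
      rec_evals gs s t -> rec_eval f t y -> rec_eval (RComp f gs) s y
  | eval_prec0 f g s y : rec_eval f s y -> rec_eval (RPrec f g) (0%N :: s) y
  | eval_precS f g n s z y :
      rec_eval (RPrec f g) (n :: s) z -> rec_eval g [:: n, z & s] y ->
      rec_eval (RPrec f g) (n.+1 :: s) y
  | eval_min f s n (v : nat -> nat) :
      (forall m, (m < n)%N -> rec_eval f (m :: s) (v m).+1) ->
      rec_eval f (n :: s) 0%N -> rec_eval (RMin f) s n
with rec_evals : seq recf -> seq nat -> seq nat -> Prop :=
  | evals_nil s : rec_evals [::] s [::]
  | evals_cons g gs s y t :
      rec_eval g s y -> rec_evals gs s t -> rec_evals (g :: gs) s (y :: t).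

(** Computability over concrete countable types is relative to the codes
    [pickle]; below only [nat], [rat], their products and finite sequences
    and a decidable subtype of these occur, whose [pickle] is an effective
    coding with decidable range. *)
Definition computable (T U : countType) (f : T -> U) : Prop :=
  exists c, forall x, rec_eval c [:: pickle x] (pickle (f x)).

Definition enumerable (T : countType) (E : set T) : Prop :=
  exists c, forall x, E x <-> exists y, rec_eval c [:: pickle x] y.

(** [ideal] is the numbering of the dense set D, which is [range ideal]. *)
HB.mixin Record isConstructiveMetric (R : realType) X
    & Metric R X & Complete X := {
  ideal : nat -> X ;
  ideal_dense : dense (range ideal) ;
  ideal_mdist_computable : exists2 q : nat * nat * nat -> rat,
    computable q &
    forall i j n,
      `|mdist (ideal i) (ideal j) - ratr (q (i, j, n))| <= 2^-1 ^+ n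
}.

#[short(type="constructiveMetricType")]
HB.structure Definition ConstructiveMetric (R : realType) :=
  {X of Metric R X & Complete X & isConstructiveMetric R X}.

HB.instance Definition _ (T U : ptopologicalType) := Pointed.on (T * U)%type.

Definition borel (T : ptopologicalType) : measurableType (@open T).-sigma :=
  g_sigma_algebraType (@open T).

(** A library measure is a function on all subsets, arbitrary outside the
    sigma-algebra; requiring the value 0 there makes Leibniz equality coincide
    with equality of measures. *)
Record pmeasure (R : realType) (X : constructiveMetricType R) := PMeasure {
  pmeasure_val :> probability (borel X) R ;
  pmeasure_out : forall A : set (borel X), ~ measurable A -> pmeasure_val A = 0%E
}.
Arguments pmeasure {R} X.

HB.instance Definition _ (R : realType) (X : constructiveMetricType R) :=
  gen_eqMixin (pmeasure X).
HB.instance Definition _ (R : realType) (X : constructiveMetricType R) :=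
  gen_choiceMixin (pmeasure X).

Section pmeasure_of.
Context (R : realType) (X : constructiveMetricType R).
Variable P : probability (borel X) R.
Local Open Scope ereal_scope.

Definition trim (A : set (borel X)) : \bar R :=
  if `[< measurable A >] then P A else 0.

Lemma trimE A : measurable A -> trim A = P A.
Proof. by move=> mA; rewrite /trim asboolT. Qed.

Let trim0 : trim set0 = 0. Proof. by rewrite trimE. Qed.

Let trim_ge0 A : 0 <= trim A.
Proof. by rewrite /trim; case: ifP. Qed.

Let trim_sigma_additive : semi_sigma_additive trim.
Proof.
move=> F mF tF mUF; rewrite trimE//.
under eq_fun do under eq_bigr do rewrite trimE//.
exact: measure_semi_sigma_additive.
Qed.

HB.instance Definition _ := isMeasure.Build _ _ _ trim
  trim0 trim_ge0 trim_sigma_additive.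

Let trimT : trim setT = 1.
Proof. by rewrite trimE// probability_setT. Qed.

HB.instance Definition _ := Measure_isProbability.Build _ _ _ trim trimT.

Let trim_out A : ~ measurable A -> trim A = 0.
Proof. by move=> mA; rewrite /trim asboolF. Qed.

Definition pmeasure_of : pmeasure X := PMeasure trim_out.

End pmeasure_of.

HB.instance Definition _ (R : realType) (X : constructiveMetricType R) :=
  isPointed.Build (pmeasure X) (pmeasure_of (\d_ (ideal 0%N : borel X))).


Lemma eq_probability d (T : measurableType d) (R : realType)
  (P Q : probability T R) : P = Q :> (set T -> \bar R) -> P = Q.
Proof.
case: P Q => [P cP] [Q cQ] /= PQ; subst Q.
case: cP cQ => [[a1 b1] [c1] [d1] [e1] [f1] [g1] [h1]].
case=> [[a2 b2] [c2] [d2] [e2] [f2] [g2] [h2]].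
rewrite (Prop_irrelevance a1 a2) (Prop_irrelevance b1 b2).
rewrite (Prop_irrelevance c1 c2) (Prop_irrelevance d1 d2).
rewrite (Prop_irrelevance e1 e2) (Prop_irrelevance f1 f2).
by rewrite (Prop_irrelevance g1 g2) (Prop_irrelevance h1 h2).
Qed.

Section prokhorov.
Context (R : realType) (X : constructiveMetricType R).
Implicit Types (P Q : pmeasure X) (A : set X) (e : R).

Lemma pmeasure_ext P Q :
  (forall A : set (borel X), measurable A -> P A = Q A) -> P = Q.
Proof.
move=> PQ.
have {PQ} : P = Q :> probability _ _.
  apply: eq_probability; apply/funext => A.
  have [/PQ//|mA] := pselect (measurable (A : set (borel X))).
  by rewrite !pmeasure_out.
case: P Q => [P Po] [Q Qo] /= PQ; subst Q.
by rewrite (Prop_irrelevance Po Qo).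
Qed.

Definition thicken A e : set (borel X) := \bigcup_(x in A) ball x e.

Local Open Scope ereal_scope.

Definition prokhorov_close P Q e :=
  forall A : set (borel X), measurable A ->
    P A <= Q (thicken A e) + e%:E /\ Q A <= P (thicken A e) + e%:E.

Definition prokhorov P Q : R :=
  inf [set e | (0 < e)%R /\ prokhorov_close P Q e].

Lemma open_borel (U : set X) : open U -> measurable (U : set (borel X)).
Proof. by move=> oU; exact: sub_sigma_algebra. Qed.

Lemma metric_ball_open (T : metricType R) (x : T) (e : R) : open (ball x e).
Proof.
rewrite openE => y; rewrite ballEmdist /= => xye.
apply/nbhs_ballP; exists (e - mdist x y)%R => /=; first by rewrite subr_gt0.
move=> z; rewrite ballEmdist/= => yz.
by rewrite (le_lt_trans (metric_triangle _ y _))// -ltrBrDl.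
Qed.

Lemma thicken_open A e : open (thicken A e : set X).
Proof. by apply: (@bigcup_open X) => x _; exact: metric_ball_open. Qed.

Lemma measurable_thicken A e : measurable (thicken A e).
Proof. by apply: open_borel; exact: thicken_open. Qed.

Lemma sub_thicken A e : (0 < e)%R -> A `<=` thicken A e.
Proof. by move=> e0 x Ax; exists x => //; exact: ballxx. Qed.

Lemma thicken_le A e e' : (e <= e')%R -> thicken A e `<=` thicken A e'.
Proof. by move=> ee' x [y Ay /(le_ball ee') yx]; exists y. Qed.

Lemma thicken_thicken A e e' :
  thicken (thicken A e) e' `<=` thicken A (e + e').
Proof. by move=> x [y [z Az zy] yx]; exists z => //; exact: ball_triangle yx. Qed.

Lemma close_sym P Q e : prokhorov_close P Q e -> prokhorov_close Q P e.
Proof. by move=> PQ A mA; have [] := PQ _ mA. Qed.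

Lemma close_le P Q e e' : (e <= e')%R ->
  prokhorov_close P Q e -> prokhorov_close P Q e'.
Proof.
move=> ee' PQ A mA; have [h1 h2] := PQ _ mA.
by split; [apply: le_trans h1 _|apply: le_trans h2 _]; apply: leeD;
  rewrite ?lee_fin//; apply: le_measure; rewrite ?inE;
  (exact: measurable_thicken || exact: thicken_le).
Qed.

Lemma close_refl P e : (0 < e)%R -> prokhorov_close P P e.
Proof.
move=> e0 A mA; suff h : P A <= P (thicken A e) + e%:E by [].
apply: (@le_trans _ _ (P (thicken A e))).
  apply: le_measure; rewrite ?inE//; first exact: measurable_thicken.
  exact: sub_thicken.
by rewrite leeDl// lee_fin ltW.
Qed.

Lemma close_trans Q P S e e' : prokhorov_close P Q e ->
  prokhorov_close Q S e' -> prokhorov_close P S (e + e').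
Proof.
have half P1 Q1 S1 d d' A : measurable (A : set (borel X)) ->
    prokhorov_close P1 Q1 d -> prokhorov_close Q1 S1 d' ->
    P1 A <= S1 (thicken A (d + d')) + (d + d')%:E.
  move=> mA /(_ _ mA)[h1 _] /(_ _ (measurable_thicken A d))[h2 _].
  apply: (le_trans h1).
  rewrite EFinD [d%:E + _]addeC addeA leeD2r//.
  apply: (le_trans h2); rewrite leeD2r//.
  apply: le_measure; rewrite ?inE; try exact: measurable_thicken.
  exact: thicken_thicken.
move=> PQ QS A mA; split; first exact: half PQ QS.
by rewrite (addrC e); apply: half mA (close_sym QS) (close_sym PQ).
Qed.

Lemma close1 P Q : prokhorov_close P Q 1.
Proof.
have half P1 Q1 A : measurable (A : set (borel X)) ->
    P1 A <= Q1 (thicken A 1) + 1%:E.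
  by move=> mA; rewrite (le_trans (probability_le1 P1 mA))// leeDr.
by move=> A mA; split; exact: half.
Qed.

Let has_inf_close P Q : has_inf [set e | (0 < e)%R /\ prokhorov_close P Q e].
Proof.
split; first by exists 1%R; split => //; exact: close1.
by exists 0%R => e [/ltW].
Qed.

Lemma prokhorov_lt P Q e : (prokhorov P Q < e)%R -> prokhorov_close P Q e.
Proof.
move=> /inf_lt; case; first exact: (has_inf_close P Q).1.
by move=> d [d0 PQ] /ltW de; exact: close_le PQ.
Qed.

Lemma prokhorov_le P Q e : (0 < e)%R -> prokhorov_close P Q e ->
  (prokhorov P Q <= e)%R.
Proof. by move=> e0 PQ; apply: ge_inf; [exact: (has_inf_close P Q).2|split]. Qed.

Lemma prokhorov_ge0 P Q : (0 <= prokhorov P Q)%R.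
Proof. by apply: lb_le_inf; [exact: (has_inf_close P Q).1|move=> e [/ltW]]. Qed.

Lemma prokhorovxx P : prokhorov P P = 0%R.
Proof.
apply/eqP; rewrite eq_le prokhorov_ge0 andbT; apply/ler_addgt0Pr => e e0.
by rewrite add0r; apply: prokhorov_le => //; exact: close_refl.
Qed.

Lemma prokhorov_sym P Q : prokhorov P Q = prokhorov Q P.
Proof.
rewrite /prokhorov; congr inf; apply/seteqP.
by split=> e [e0 /close_sym ?]; split.
Qed.

Lemma prokhorov_triangle Q P S :
  (prokhorov P S <= prokhorov P Q + prokhorov Q S)%R.
Proof.
apply/ler_addgt0Pr => e e0; have e20 : (0 < e / 2)%R by rewrite divr_gt0.
rewrite [e in leRHS]splitr addrACA; apply: prokhorov_le.
  by rewrite addr_gt0// ltr_wpDl// prokhorov_ge0.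
by apply: (@close_trans Q); apply: prokhorov_lt; rewrite ltrDl.
Qed.

Let closed_le P Q (F : set X) : prokhorov P Q = 0%R -> closed F -> P F <= Q F.
Proof.
move=> PQ0 cF.
have mF : measurable (F : set (borel X)).
  by rewrite -[F]setCK; apply: measurableC; apply: open_borel; exact: closed_openC.
pose e n : R := (n.+1%:R^-1)%R.
have e0 n : (0 < e n)%R by rewrite /e invr_gt0.
have FE : \bigcap_n (thicken F (e n)) = F.
  apply/seteqP; split => [x Fx|x Fx n _]; last exact: sub_thicken.
  apply: cF => B /nbhs_ballP[d /= d0 dB].
  have [n nd] : exists n, (e n < d)%R.
    have /cvgrPdist_lt/(_ _ d0)[n _ /(_ _ (leqnn n))] := @cvg_harmonic R.
    by rewrite sub0r normrN gtr0_norm//; exists n.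
  have [y Fy yx] := Fx n I.
  by exists y; split => //; apply: dB; apply: ball_sym; exact: le_ball (ltW nd) _ yx.
have cvgQ : Q (thicken F (e n)) @[n --> \oo] --> Q F.
  rewrite -[X in _ --> Q X]FE; apply: nonincreasing_cvg_mu.
  - by rewrite (le_lt_trans (probability_le1 _ _))// ?ltry//; exact: measurable_thicken.
  - by move=> n; exact: measurable_thicken.
  - by rewrite FE.
  - move=> m n mn; apply/subsetPset; apply: thicken_le.
    by rewrite /e lef_pV2 ?posrE// ler_nat ltnS.
have cvge : (e n)%:E @[n --> \oo] --> (0%R : R)%:E.
  by apply/fine_cvgP; split; [exact: nearW|exact: cvg_harmonic].
have : Q (thicken F (e n)) + (e n)%:E @[n --> \oo] --> Q F + 0%:E.
  by apply: cvgeD; [exact: fin_num_adde_defl|exact: cvgQ|exact: cvge].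
rewrite adde0 => h; apply: (cvge_ge _ h); apply: nearW => n.
by have [] := @prokhorov_lt P Q (e n) _ F mF; rewrite ?PQ0.
Qed.

Lemma prokhorov_positivity P Q : prokhorov P Q = 0%R -> P = Q.
Proof.
move=> PQ0; have QP0 : prokhorov Q P = 0%R by rewrite prokhorov_sym.
apply: pmeasure_ext => A mA.
apply: (@measure_unique _ _ (borel X) (@open X) (fun=> setT)) => //.
- by move=> U V; exact: openI.
- by move=> _; exact: openT.
- by rewrite bigcup_const.
- move=> U oU; have mU := open_borel oU.
  have PQC : P (~` U) = Q (~` U).
    by apply/eqP; rewrite eq_le !closed_le//; exact: open_closedC.
  rewrite -[U]setCK [LHS]probability_setC; last exact: measurableC.
  by rewrite [RHS]probability_setC ?PQC//; exact: measurableC.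
- by move=> _; rewrite [ltLHS]probability_setT ltry.
Qed.

HB.instance Definition _ := isMetric.Build R (pmeasure X)
  prokhorovxx prokhorov_positivity prokhorov_sym prokhorov_triangle.

End prokhorov.

(** Codes of finite rational convex combinations: sequences of pairs
    (number of a point of D, weight). *)
Definition rational_weights (s : seq (nat * rat)) : bool :=
  all (fun p => 0 <= p.2) s && (\sum_(p <- s) p.2 == 1).

Definition rmcode : countType := {s : seq (nat * rat) | rational_weights s}.

Section rational_measure.
Context (R : realType) (X : constructiveMetricType R).
Local Open Scope ereal_scope.

Definition dirac_comb (s : seq (nat * rat)) (A : set (borel X)) : \bar R :=
  \sum_(p <- s) (ratr p.2)%:E * \d_(ideal p.1 : borel X) A.

Variable c : rmcode.

Let comb := dirac_comb (val c).

Let weight_ge0 p : p \in val c -> 0 <= (ratr p.2 : R)%:E.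
Proof. by have /andP[/allP h _] := valP c; move/h; rewrite lee_fin ler0q. Qed.

Let comb0 : comb set0 = 0.
Proof. by rewrite /comb /dirac_comb big1// => p _; rewrite measure0 mule0. Qed.

Let comb_ge0 A : 0 <= comb A.
Proof.
rewrite /comb /dirac_comb big_seq; apply: sume_ge0 => p /weight_ge0 p0.
by rewrite mule_ge0.
Qed.

Let comb_sigma_additive : semi_sigma_additive comb.
Proof.
move=> F mF tF mUF.
rewrite [X in X @ _ --> _](_ : _ = fun n => \sum_(p <- val c | p \in val c)
    (ratr p.2)%:E * \sum_(0 <= i < n) \d_(ideal p.1 : borel X) (F i)).
  rewrite /comb /dirac_comb big_seq.
  apply: cvg_nnesum => p pc.
    apply: nearW => n; rewrite mule_ge0 ?weight_ge0//.
    by apply: sume_ge0.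
  by apply: cvgeZl => //; exact: measure_semi_sigma_additive.
apply/funext => n; rewrite -big_seq exchange_big/=; apply: eq_bigr => p _.
by rewrite ge0_sume_distrr.
Qed.

HB.instance Definition _ := isMeasure.Build _ _ _ comb
  comb0 comb_ge0 comb_sigma_additive.

Let combT : comb setT = 1.
Proof.
rewrite /comb /dirac_comb; under eq_bigr do rewrite diracT mule1.
have /andP[_ /eqP h] := valP c.
by rewrite sumEFin -rmorph_sum h rmorph1.
Qed.

HB.instance Definition _ := Measure_isProbability.Build _ _ _ comb combT.

Definition rational_measure : pmeasure X := pmeasure_of comb.

End rational_measure.
Arguments rational_measure {R X}.

Section tests.
Context (R : realType) (X : constructiveMetricType R).
Implicit Types (f s t : X * pmeasure X -> \bar R) (C : set (pmeasure X)).

(** Open balls with nonpositive radius are empty. *)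
Definition basic_ball (I : countType) (T : metricType R) (a : I -> T)
  (b : I * rat) : set T := ball (a b.1) (ratr b.2).

Definition basic_product (b : (nat * rat) * (rmcode * rat)) :
    set (X * pmeasure X) :=
  basic_ball ideal b.1 `*` basic_ball rational_measure b.2.

Definition lower_semicomputable f : Prop :=
  exists2 E : set (rat * ((nat * rat) * (rmcode * rat))),
    enumerable E &
    forall r, [set z | ((ratr r)%:E < f z)%E] =
      \bigcup_(b in [set b | E (r, b)]) basic_product b.

Definition uniform_test f : Prop :=
  [/\ forall z, (0 <= f z)%E,
      lower_semicomputable f &
      forall P : pmeasure X, (\int[P]_x f (x, P) <= 1)%E].

Definition universal_test t : Prop :=
  uniform_test t /\
  forall f, uniform_test f ->
    exists2 c : R, 0 < c & forall z, (f z <= c%:E * t z)%E.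

Definition randoms t (P : pmeasure X) : set X :=
  [set x | (t (x, P) < +oo)%E].

Definition effectively_orthogonal t C : Prop :=
  forall P Q, C P -> C Q -> P <> Q -> randoms t P `&` randoms t Q = set0.

Definition borel_class C : Prop := measurable (C : set (borel (pmeasure X))).

Definition orthogonal_class C : Prop :=
  exists phi : borel X -> borel (pmeasure X),
    [/\ forall x, C (phi x),
        measurable_fun setT phi &
        forall P : pmeasure X, C P -> P (phi @^-1` [set P]) = 1%E].

Definition separator C s : Prop :=
  [/\ forall z, (0 <= s z)%E,
      measurable_fun setT (s : borel (X * pmeasure X)%type -> \bar R),
      forall P : pmeasure X, (\int[P]_x s (x, P) <= 1)%E &
      forall P Q, C P -> C Q -> P <> Q ->
        forall x, s (x, P) = +oo%E \/ s (x, Q) = +oo%E].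

Definition test_separator C s : Prop :=
  separator C s /\ lower_semicomputable s.

End tests.

(* Main.v *)
(** A test-separator is a uniform test, so it is dominated by the universal
    test; conversely the universal test is itself Borel, its superlevel sets
    being open. This gives (b).

    For (a), put [s (x, P) = +oo] when [P] is in [C] and [phi x <> P], and
    [s (x, P) = 0] otherwise. The point is that [phi x <> P] is a Borel
    condition on [(x, P)]: probability measures are separated by the countably
    many sets [{P | q < P U}], [q] rational and [U] a finite union of basic
    balls, and these are open for the Prokhorov metric. *)
Require Import Defs.
From mathcomp Require Import all_boot all_order all_algebra.
From mathcomp Require Import all_classical all_reals all_analysis.
From mathcomp Require Import measurable_realfun.
Import Order.TTheory GRing.Theory Num.Theory.
Import numFieldNormedType.Exports.
Local Open Scope classical_set_scope.
Local Open Scope ring_scope.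

(** * Borel measurability from open sets *)

Lemma continuous_borel_measurable (T U : ptopologicalType) (f : T -> U) :
  continuous f -> measurable_fun setT (f : borel T -> borel U).
Proof.
move=> cf; apply: (@measurability _ _ (borel T) (borel U) setT f (@open U)) => // _ [B oB <-].
apply: sub_sigma_algebra; rewrite setTI.
by move/continuousP : cf; exact.
Qed.

Lemma measurable_borel_fst (T U : ptopologicalType) :
  measurable_fun setT (fst : borel (T * U)%type -> borel T).
Proof. by apply: continuous_borel_measurable => z; exact: cvg_fst. Qed.

Lemma measurable_borel_snd (T U : ptopologicalType) :
  measurable_fun setT (snd : borel (T * U)%type -> borel U).
Proof. by apply: continuous_borel_measurable => z; exact: cvg_snd. Qed.

(** Rational thresholds suffice: if [r < f z] for a real [r], some rational lies between them, so
    [{f > r}] is the union of the open sets [{f > q}] over rational [q >= r]. *)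
Lemma open_superlevel_measurable (R : realType) (T : ptopologicalType)
    (f : T -> \bar R) :
  (forall q : rat, open [set z | ((ratr q)%:E < f z)%E]) ->
  measurable_fun setT (f : borel T -> \bar R).
Proof.
move=> of_; apply: (measurability _ (ErealGenOInfty.measurableE R)).
move=> _ [_ [r ->] <-]; rewrite setTI preimage_itvoy.
rewrite (_ : [set _ | _] = \bigcup_(q in [set q : rat | r <= ratr q])
    [set z | ((ratr q)%:E < f z)%E]).
  by apply: sub_sigma_algebra; apply: (@bigcup_open T).
apply/seteqP; split => [z /= rfz|z [q /= rq]]; last first.
  by apply: le_lt_trans; rewrite lee_fin.
suff [q rq qf] : exists2 q : rat, r <= ratr q & ((ratr q)%:E < f z)%E by exists q.
move: rfz; case: (f z) => [y||] //=.
- rewrite lte_fin => /rat_in_itvoo[q]; rewrite in_itv/= => /andP[rq qy].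
  by exists q; rewrite ?ltW ?lte_fin.
(* When [f z] is [+oo] any rational above [r] works; [r + 1] only supplies a nonempty interval. *)
- have /rat_in_itvoo[q] : r < r + 1 by rewrite ltrDl.
  rewrite in_itv/= => /andP[rq _] _.
  by exists q; rewrite ?ltW ?ltry.
Qed.

(** * Values of a measure on open sets *)

Section prokhorov_borel.
Context (R : realType) (X : constructiveMetricType R).
Implicit Types (P Q : pmeasure X) (U : set X).
Local Open Scope ereal_scope.

(** Finite unions, not single balls: continuity from below needs an increasing sequence exhausting
    an open set. Coding them by lists keeps the family countable. *)
Definition ball_union (l : seq (nat * rat)) : set X :=
  \bigcup_(b in [set` l]) basic_ball ideal b.

Lemma ball_union_open l : open (ball_union l).
Proof. by apply: bigcup_open => b _; exact: metric_ball_open. Qed.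

Lemma basic_ball_nbhs U (x : X) : open U -> U x ->
  exists b : nat * rat, basic_ball ideal b x /\ basic_ball ideal b `<=` U.
Proof.
move=> oU Ux.
have /nbhs_ballP[e /= e0 eU] : nbhs x U by exact: open_nbhs_nbhs.
have e40 : (0 < e / 4)%R by rewrite divr_gt0.
have [_ [/[swap] [[i _ <-]] xi]] : ball x (e / 4) `&` range ideal !=set0.
  apply: ideal_dense; last exact: metric_ball_open.
  by exists x; exact: ballxx.
(* The centre is within [e / 4] of [x]. A radius above [e / 4] captures [x]; a radius below [e / 2]
   keeps the ball inside [ball x e]. *)
have /rat_in_itvoo[q] : (e / 4 < e / 2)%R.
  by rewrite ltr_pM2l// ltf_pV2 ?posrE// ltr_nat.
rewrite in_itv/= => /andP[q1 q2]; exists (i, q); split.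
  by apply: ball_sym; exact: le_ball (ltW q1) _ xi.
move=> y iy; apply: eU; rewrite (splitr e); apply: (@ball_triangle _ _ (ideal i)).
- by apply: le_ball xi; rewrite (le_trans (ltW q1))// ltW.
- by apply: le_ball iy; exact: ltW.
Qed.

Lemma open_bigcup_ball_union U : open U ->
  exists l : nat -> seq (nat * rat),
    U = \bigcup_n ball_union (l n) /\
    {homo (fun n => ball_union (l n)) : m n / (m <= n)%N >-> m `<=` n}.
Proof.
move=> oU.
(* [l n] keeps the balls inside [U] whose code is below [n], so the lists grow with [n] and the ball
   [b] first appears at index [(pickle b).+1]. *)
pose l n := [seq b <- pmap unpickle (iota 0 n) |
  `[< basic_ball ideal b `<=` U >]] : seq (nat * rat).
exists l; split.
  apply/seteqP; split => [x Ux|x [n _ [b /=]]]; last first.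
    by rewrite mem_filter => /andP[/asboolP bU _]; exact: bU.
  have [b [bx bU]] := basic_ball_nbhs _ _ oU Ux.
  exists (pickle b).+1 => //; exists b => //.
  rewrite /mkset mem_filter asboolT// mem_pmap; apply/mapP; exists (pickle b).
    by rewrite mem_iota add0n ltnSn.
  by rewrite pickleK.
move=> m n mn x [b /= bm bx]; exists b => //=; move: bm.
rewrite !mem_filter => /andP[-> /=]; rewrite !mem_pmap => /mapP[k km ->].
by apply: map_f; move: km; rewrite !mem_iota/= => /leq_trans; exact.
Qed.

(** Continuity from below carries the agreement to all open sets, an intersection-stable family
    generating the Borel sets; uniqueness of measures concludes. *)
Lemma pmeasure_ball_union_ext P Q :
  (forall l, P (ball_union l) = Q (ball_union l)) -> P = Q.
Proof.
move=> PQ; apply: pmeasure_ext => A mA.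
apply: (@measure_unique _ _ (borel X) (@open X) (fun=> setT)) => //.
- by move=> U V; exact: openI.
- by move=> _; exact: openT.
- by rewrite bigcup_const.
- move=> U oU; have [l [UE ndl]] := open_bigcup_ball_union _ oU.
  have cvgl (S : pmeasure X) : S (ball_union (l n)) @[n --> \oo] --> S U.
    rewrite [in X in _ --> X]UE; apply: nondecreasing_cvg_mu.
    + by move=> n; apply: open_borel; exact: ball_union_open.
    + by rewrite -UE; exact: open_borel.
    + by move=> m n mn; apply/subsetPset; exact: ndl.
  have := cvgl P; under eq_fun do rewrite PQ.
  by move=> hP; apply: cvg_unique hP (cvgl Q).
- by move=> _; rewrite [ltLHS]probability_setT ltry.
Qed.

(** The set [~` thicken (~` U) e] consists of the points whose [e]-ball lies in
    [U]; it increases to [U] as [e] decreases to 0. *)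
Lemma measure_gt_open U (r : R) : open U -> open [set P : pmeasure X | r%:E < P U].
Proof.
move=> oU; rewrite openE => P /= rPU.
pose core n : set (borel X) := ~` thicken (~` U) n.+1%:R^-1.
have mcore n : measurable (core n).
  by apply: measurableC; exact: measurable_thicken.
have coreE : \bigcup_n core n = U.
  apply/seteqP; split => [x [n _ nx]|x Ux].
    by apply: contrapT => Ux; apply: nx; exact: sub_thicken.
  have /nbhs_ballP[e /= e0 eU] : nbhs x U by exact: open_nbhs_nbhs.
  have /cvgrPdist_lt/(_ _ e0)[n _ /(_ _ (leqnn n))] := @cvg_harmonic R.
  rewrite sub0r normrN gtr0_norm ?harmonic_gt0// => ne.
  exists n => // -[y Uy yx]; apply: Uy; apply: eU; apply: ball_sym.
  exact: le_ball (ltW ne) _ yx.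
have ndcore : {homo core : m n / (m <= n)%N >-> m `<=` n}.
  move=> m n mn; apply: subsetC; apply: thicken_le.
  by rewrite lef_pV2 ?posrE// ler_nat ltnS.
have cvgP : P (core n) @[n --> \oo] --> P U.
  rewrite -[X in _ --> P X]coreE; apply: nondecreasing_cvg_mu => //.
    by rewrite coreE; exact: open_borel.
  by move=> m n mn; apply/subsetPset; exact: ndcore.
have [n rPn] : exists n, r%:E < P (core n).
  apply: contrapT => /forallNP h.
  move: rPU; apply/negP; rewrite -leNgt; apply: (cvge_le _ cvgP).
  by apply: nearW => n; rewrite leNgt; apply/negP; exact: h.
(* The first bound keeps the [d / 2]-thickening of [core n] inside [U]. The second gives
   [d + r <= P (core n) <= Q U + d / 2]; halving the radius makes [r < Q U] strict. *)
pose d : R := (Num.min n.+1%:R^-1 (fine (P (core n)) - r))%R.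
have finPn : P (core n) \is a fin_num by exact: fin_num_measure.
have d0 : (0 < d)%R.
  by rewrite lt_min invr_gt0 ltr0n/= subr_gt0 -lte_fin fineK.
apply/nbhs_ballP; exists (d / 2)%R; first by rewrite /= divr_gt0.
move=> Q; rewrite ballEmdist /= => PQ.
have [+ _] := prokhorov_lt PQ (mcore n).
have d2d : (d / 2 < d)%R by rewrite ltr_pdivrMr// ltr_pMr// ltr1n.
have QU : Q (thicken (core n) (d / 2)) <= Q U.
  apply: le_measure; rewrite ?inE; [exact: measurable_thicken|exact: open_borel|].
  move=> x [y yn yx]; apply: contrapT => Ux; apply: yn; exists x => //.
  apply: ball_sym; apply: le_ball yx.
  by rewrite (le_trans (ltW d2d))// ge_min lexx.
have finQU : Q U \is a fin_num by apply: fin_num_measure; exact: open_borel.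
move=> /le_trans/(_ (leeD2r (d / 2)%:E QU)).
rewrite -(fineK finPn) -(fineK finQU) -EFinD lee_fin lte_fin => h.
rewrite -(ltrD2r (d / 2)%R); apply: lt_le_trans h.
have : (d + r <= fine (P (core n)))%R by rewrite -lerBrDr /d ge_min lexx orbT.
by apply: lt_le_trans; rewrite addrC ltrD2r.
Qed.

(** * Separating measures by countably many open conditions *)

Definition measure_gt (i : seq (nat * rat) * rat) : set (borel (pmeasure X)) :=
  [set P | (ratr i.2)%:E < P (ball_union i.1)].

Lemma measurable_measure_gt i : measurable (measure_gt i).
Proof.
by apply: sub_sigma_algebra; apply: measure_gt_open; exact: ball_union_open.
Qed.

(** Distinct measures differ on some ball union, and a rational between the two values gives the
    index. *)
Lemma measure_gt_separates P Q : P <> Q ->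
  exists i, (measure_gt i P /\ ~ measure_gt i Q) \/
            (~ measure_gt i P /\ measure_gt i Q).
Proof.
have sep P1 Q1 l : P1 (ball_union l) < Q1 (ball_union l) ->
    exists i, ~ measure_gt i P1 /\ measure_gt i Q1.
  have fin (S : pmeasure X) : S (ball_union l) \is a fin_num.
    by apply: fin_num_measure; apply: open_borel; exact: ball_union_open.
  rewrite -(fineK (fin P1)) -(fineK (fin Q1)) lte_fin => /rat_in_itvoo[q].
  rewrite in_itv/= => /andP[q1 q2]; exists (l, q); rewrite /measure_gt/=.
  rewrite -(fineK (fin P1)) -(fineK (fin Q1)) !lte_fin; split => //.
  by apply/negP; rewrite -leNgt ltW.
move=> PQ.
have [l /eqP] : exists l, P (ball_union l) <> Q (ball_union l).
  apply/existsNP => h; apply: PQ; exact: pmeasure_ball_union_ext.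
rewrite neq_lt => /orP[/sep[i h]|/sep[i [h1 h2]]].
- by exists i; right.
- by exists i; left.
Qed.

Lemma measurable_neq_graph (phi : borel X -> borel (pmeasure X)) :
  measurable_fun setT phi ->
  measurable [set z : borel (X * pmeasure X)%type | phi z.1 <> z.2].
Proof.
move=> mphi.
have mfst := measurable_borel_fst X (pmeasure X).
have msnd := measurable_borel_snd X (pmeasure X).
have m1 i : measurable [set z : borel (X * pmeasure X)%type |
    measure_gt i (phi z.1)].
  by rewrite -[X in measurable X]setTI; apply: (measurableT_comp mphi mfst) => //;
    exact: measurable_measure_gt.
have m2 i : measurable [set z : borel (X * pmeasure X)%type | measure_gt i z.2].
  by rewrite -[X in measurable X]setTI; apply: msnd => //; exact: measurable_measure_gt.
(* Two measures differ exactly when some [measure_gt i] contains one and not the other; the indices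
   [i] are countable. *)
rewrite (_ : [set _ | _] = \bigcup_i
    (([set z : borel (X * pmeasure X)%type | measure_gt i (phi z.1)] `\`
      [set z | measure_gt i z.2]) `|`
     ([set z : borel (X * pmeasure X)%type | measure_gt i z.2] `\`
      [set z | measure_gt i (phi z.1)]))).
  apply: countable_bigcupT_measurable => // i.
  by apply: measurableU; exact: measurableD.
apply/seteqP; split => [z /= /measure_gt_separates[i [[h1 h2]|[h1 h2]]]|z [i _]].
- by exists i => //; left.
- by exists i => //; right.
- by move=> [[/= h1 h2]|[/= h1 h2]] E; apply: h2; rewrite -?E// E.
Qed.

(** Superlevel sets at rational thresholds are unions of products of open balls, hence open. *)
Lemma lower_semicomputable_measurable (f : X * pmeasure X -> \bar R) :
  lower_semicomputable f ->
  measurable_fun setT (f : borel (X * pmeasure X)%type -> \bar R).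
Proof.
move=> [E _ fE]; apply: open_superlevel_measurable => q; rewrite fE.
apply: (@bigcup_open (X * pmeasure X)%type) => b _.
rewrite openE => z [z1 z2].
exists (basic_ball ideal b.1, basic_ball rational_measure b.2) => //=.
by split; apply: open_nbhs_nbhs; split => //; exact: metric_ball_open.
Qed.

(** * Construction of separators *)

Lemma orthogonal_separator (C : set (pmeasure X)) :
  borel_class C -> orthogonal_class C -> exists s, separator C s.
Proof.
move=> mC [phi [phiC mphi phi1]].
pose N : set (borel (X * pmeasure X)%type) := [set z | C z.2 /\ phi z.1 <> z.2].
have mN : measurable N.
  apply: measurableI; last exact: measurable_neq_graph.
  rewrite -[X in measurable X]setTI.
  exact: (measurable_borel_snd X (pmeasure X)).
pose s (z : X * pmeasure X) : \bar R := if z \in N then +oo else 0.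
exists s; split.
- by move=> z; rewrite /s; case: ifP.
- apply: measurable_fun_ifT => //; apply: (measurable_fun_bool true).
  by rewrite setTI (_ : _ @^-1` _ = N)//; apply/seteqP; split => z;
    [exact: set_mem|exact: mem_set].
- move=> P.
  (* The integral bound concerns all measures; for [P] outside [C] the condition [C z.2] in [N]
     makes [s (x, P)] vanish identically. *)
  have [CP|nCP] := pselect (C P); last first.
    rewrite integral0_eq// => x _; rewrite /s.
    by case: ifPn => //; rewrite inE => -[].
  (* Singletons are closed in the Prokhorov metric, hence Borel. *)
  have mP : measurable (phi @^-1` [set P]).
    rewrite -[X in measurable X]setTI; apply: mphi => //.
    rewrite -[X in measurable X]setCK; apply: measurableC.
    apply: sub_sigma_algebra; apply: (@closed_openC (pmeasure X)).
    apply: accessible_closed_set1; apply: hausdorff_accessible.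
    exact: metric_hausdorff.
  have P0 : P (~` (phi @^-1` [set P])) = 0.
    by rewrite probability_setC// phi1// subee.
  rewrite (_ : \int[P]_x _ = 0)//.
  (* The section is [+oo] on a [P]-null set and 0 elsewhere, and [+oo * 0 = 0]. *)
  rewrite (_ : (fun x => s (x, P)) =
      ((cst +oo) \_ (~` (phi @^-1` [set P]))) :> (borel X -> \bar R)).
    rewrite -integral_mkcond integral_cst; last exact: measurableC.
    by rewrite [X in _ * X](_ : _ = 0) ?mule0//.
  apply/funext => x; rewrite patchE /s.
  have [xP|xP] := eqVneq (phi x) P.
    by rewrite !ifF//; apply/negbTE; rewrite notin_setE/= ?xP => -[].
  by rewrite !ifT// inE/=; [exact/eqP|split => //; exact/eqP].
- move=> P Q CP CQ PQ x.
  (* [phi x] equals at most one of [P] and [Q]; [s] is infinite at the other. *)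
  have [xP|/eqP xP] := eqVneq (phi x) P.
    by right; rewrite /s ifT// inE /N/= xP.
  by left; rewrite /s ifT// inE /N/=.
Qed.

Lemma effectively_orthogonalP (C : set (pmeasure X)) t : universal_test t ->
  effectively_orthogonal t C <-> exists s, test_separator C s.
Proof.
move=> [[t0 lt it] tmax]; split => [Ct|[s [[s0 _ is_ sC] ls]] P Q CP CQ PQ].
  exists t; split => //; split => //; first exact: lower_semicomputable_measurable.
  move=> P Q CP CQ PQ x; apply: contrapT => /not_orP[/eqP tP /eqP tQ].
  have : (randoms t P `&` randoms t Q) x by rewrite /randoms/= !ltey.
  by rewrite Ct.
have [c c0 sct] : exists2 c : R, (0 < c)%R & forall z, s z <= c%:E * t z.
  exact: tmax.
(* As [c] is finite, a point random for both [P] and [Q] would make both values of [s] finite. *)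
have sfin z : t z < +oo -> s z < +oo.
  by move=> tz; rewrite (le_lt_trans (sct z))// lte_mul_pinfty// lee_fin ltW.
rewrite -subset0 => x [/sfin + /sfin].
by have [->|->] := sC P Q CP CQ PQ x; rewrite ltxx.
Qed.

End prokhorov_borel.

Theorem theorem27 (R : realType) (X : constructiveMetricType R)
    (C : set (pmeasure X)) :
  (borel_class C -> orthogonal_class C ->
     exists s : X * pmeasure X -> \bar R, separator C s) /\
  (forall t : X * pmeasure X -> \bar R, universal_test t ->
     (effectively_orthogonal t C <->
      exists s : X * pmeasure X -> \bar R, test_separator C s)).
Proof.
split; first exact: orthogonal_separator.
by move=> t; exact: effectively_orthogonalP.
Qed.
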